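(* Let $E$ be a Banach space, let $C\subseteq E$ be nonempty, convex and compact, let $K:C\rightrightarrows C$ be a lower semicontinuous set-valued map with convex and nonempty images, and let $f:C\times C\to\mathbb{R}$ be a function such that: (i) the function $f(\cdot,y)$ is lower semicontinuous for every $y\in C$; (ii) the function $f(x,\cdot)$ is quasiconcave for every $x\in C$; (iii) there is $\varepsilon_0>0$ such that $f(x,x)\le 0$ for every $x\in C$ satisfying $x\in (K(x)+\varepsilon_0 B)\cap C$. For $\varepsilon>0$ define $K_\varepsilon:C\rightrightarrows C$ by $K_\varepsilon(x)=(K(x)+\varepsilon B)\cap C$. Then for each $\varepsilon$ with $0<\varepsilon<\varepsilon_0$ (where $\varepsilon_0$ is as in (iii)) there exists $x_\varepsilon\in \mathrm{cl}\,(\mathrm{fix}\,K_\varepsilon)$ such that $$f(x_\varepsilon,y)\le 0\qquad\text{for all } y\in K_\varepsilon(x_\varepsilon).$$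
   Context: $B$ denotes the open unit ball of $E$ and $\mathrm{cl}$ denotes closure. A set-valued map $K:C\rightrightarrows C$ assigns to each $x\in C$ a subset $K(x)\subseteq C$; it is lower semicontinuous if for every (relatively) open $A\subseteq C$ the set $\{x\in C:K(x)\cap A\ne\emptyset\}$ is (relatively) open in $C$. The fixed point set of a set-valued map $F:C\rightrightarrows C$ is $\mathrm{fix}\,F=\{x\in C: x\in F(x)\}$. A real function on a convex set is quasiconcave if all its upper level sets are convex. *)

(* Defs.v *)
From HB Require Import structures.
From mathcomp Require Import all_boot all_order all_algebra.
From mathcomp Require Import all_classical all_reals all_analysis.
Import Order.TTheory GRing.Theory Num.Theory.
Import numFieldNormedType.Exports.

Set Implicit Arguments.
Unset Strict Implicit.
Unset Printing Implicit Defensive.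

Local Open Scope classical_set_scope.
Local Open Scope ring_scope.

(* A set-valued map from C to C is a total function K : E -> set E such that
   K x is contained in C for x in C, and a function C * C -> R is a total
   function E -> E -> R. Their values at points outside C are junk: they
   do not affect the conditions on C defined below. *)

Definition setvalued_map (E : Type) (C : set E) (K : E -> set E) : Prop :=
  forall x, C x -> K x `<=` C.

(* Relatively open subsets of C are the open sets of [subspace C] that are
   included in C (all the points outside C are isolated in [subspace C]). *)
Definition setvalued_lsc (E : topologicalType) (C : set E) (K : E -> set E)
    : Prop :=
  forall A : set E, A `<=` C -> open (A : set (subspace C)) ->
    open ([set x | C x /\ (K x `&` A) !=set0] : set (subspace C)).

(* Since the points outside C are isolated in [subspace C], this is lower
   semicontinuity of the restriction of g to C. *)
Definition lsc_on (E : topologicalType) (R : realType) (C : set E) (g : E -> R)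
    : Prop :=
  lower_semicontinuous (fun x : subspace C => (g x)%:E).

Definition quasiconcave_on (R : realType) (E : lmodType R) (C : set E)
    (g : E -> R) : Prop :=
  forall a : R, convex_set [set y : E | C y /\ a <= g y].

Definition setvalued_fix (E : Type) (C : set E) (F : E -> set E) : set E :=
  [set x | C x /\ F x x].

Definition enlarge (R : realType) (E : normedModType R) (C : set E)
    (K : E -> set E) (e : R) (x : E) : set E :=
  [set u + e *: b | u in K x & b in ball (0 : E) 1] `&` C.

(* Main.v *)
(** If no point is as required, let [H x] be [K_eps x] for [x] outside
[F := cl (fix K_eps)], and the set of the [y] in [K_eps x] with [f x y > 0] for
[x] in [F]. Then [H] has nonempty convex values and open lower sections, so by
the Fan-Browder theorem [x] is in [H x] for some [x] in [C]: then [x] is in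
[fix K_eps], hence in [F], hence [f x x > 0], which contradicts (iii).

For Fan-Browder, [C] is covered by finitely many balls [ball x (e x)] such that
[y x] is in [H z] for all [z] of [C] in [ball x (2 * e x)]. A grid point of the
simplex on these [y]'s is coloured by a ball that contains the corresponding
point of [C]. Scarf's theorem on families of linear orders, which replaces
Sperner's lemma and needs no triangulation, yields grid points close to each
other whose colours include the support of a nearby grid point; the point of
[C] corresponding to the latter is fixed. *)

Require Import Defs.
From mathcomp Require Import all_boot.
From mathcomp Require Import zify.

Set Implicit Arguments.
Unset Strict Implicit.
Unset Printing Implicit Defensive.

(** * Scarf's theorem on families of linear orders *)

Section Scarf.
Variables (I V : finType) (r : I -> V -> nat) (s : I -> V) (c : V -> I).
Implicit Types (i j k : I) (v w x y : V) (A B : {set V}).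

(** For nonempty [A]: no element exceeds the minimum of [A] in all the orders at once. Dominant sets
    stand in for the simplices of a triangulation. *)
Definition dominant A :=
  [forall x, exists i, forall (a | a \in A), r i x <= r i a].

Hypotheses (cardI : 1 < #|I|) (r_inj : forall i, injective (r i)).
(* [s i] is a slack element: its presence in a set means that the [i]-th order
is not used, so that all the sets considered have about [#|I|] elements. *)
Hypotheses (r_min : forall i v, r i (s i) <= r i v)
  (r_max : forall i j v, v \notin codom s -> i != j -> r i v < r i (s j))
  (proper : exists v, v \notin codom s) (cs : cancel s c).

Variable i0 : I.

(* Each door other than [door0] lies in 0 or 2 rooms and [door0] in exactly 1;
a room contains 1 door if its colours are all distinct, and 0 or 2 otherwise.
Hence the number of rooms with all colours is odd. *)
Let room A := dominant A && (#|A| == #|I|).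
Let door B := (c @: B == [set~ i0]) && (#|B|.+1 == #|I|).
Let door0 := s @: [set~ i0].

Lemma dominantP A :
  reflect (forall x, exists i, forall a, a \in A -> r i x <= r i a)
          (dominant A).
Proof.
apply: (iffP forallP) => h x; have := h x.
  by move=> /existsP[i /forall_inP hi]; exists i.
by move=> [i hi]; apply/existsP; exists i; apply/forall_inP.
Qed.

Lemma dominantS A B : B \subset A -> dominant A -> dominant B.
Proof.
move=> /subsetP BA /dominantP dA; apply/dominantP => x.
by have [i hi] := dA x; exists i => a /BA; exact: hi.
Qed.

Lemma door_inj B : door B -> {in B &, injective c}.
Proof.
move=> /andP[/eqP cB /eqP nB]; apply/imset_injP.
rewrite cB cardsC1; lia.
Qed.

(** A door in [A] is [A] minus one element. If [A] has all colours, this element is the one of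
    colour [i0]. Otherwise, if [A :\ v] is a door, [c v] is the colour of exactly one other [w] in
    [A], and the doors are [A :\ v] and [A :\ w]. *)
Lemma odd_doors_of_room A : room A ->
  odd #|[set B : {set V} | door B & B \subset A]| = (c @: A == setT).
Proof.
move=> /andP[_ /eqP nA].
have subD B : door B -> B \subset A -> exists2 v, v \in A & B = A :\ v.
  move=> /andP[_ /eqP nB] BA.
  have : #|A :\: B| == 1 by rewrite cardsD (setIidPr BA) nA; lia.
  case/cards1P=> v Ev; exists v.
    by have := set11 v; rewrite -Ev inE => /andP[].
  by rewrite -Ev setDDr setDv set0U (setIidPr BA).
have cardA v : v \in A -> #|A :\ v|.+1 = #|I|.
  by move=> vA; rewrite -nA (cardsD1 v A) vA.
case: eqP => [cA|/eqP cA].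
  have cinj : {in A &, injective c} by apply/imset_injP; rewrite cA cardsT nA.
  have /imsetP[v vA cv] : i0 \in c @: A by rewrite cA inE.
  suff -> : [set B : {set V} | door B & B \subset A] = [set A :\ v].
    by rewrite cards1.
  apply/setP => B; rewrite !inE; apply/idP/eqP => [/andP[dB BA]|->].
    have [w wA EB] := subD _ dB BA; rewrite EB; congr (_ :\ _).
    apply: (cinj) => //; rewrite -cv; apply/eqP/negPn/negP => ncw.
    have /imsetP[u] : c w \in c @: B.
      by case/andP: dB => /eqP -> _; rewrite !inE.
    rewrite EB !inE => /andP[uw uA] /(cinj _ _ wA uA) wu.
    by rewrite wu eqxx in uw.
  rewrite subD1set andbT; apply/andP; split; last by rewrite cardA.
  apply/eqP/setP => i; rewrite !inE; apply/imsetP/idP => [[u]|ii0].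
    rewrite !inE cv => /andP[uv uA] ->; apply: contra uv => /eqP.
    by move=> /(cinj _ _ uA vA) ->.
  have /imsetP[u uA iu] : i \in c @: A by rewrite cA inE.
  exists u => //; rewrite !inE uA andbT; apply: contra ii0 => /eqP uv.
  by rewrite iu uv cv.
have [->|[B]] := set_0Vmem [set B : {set V} | door B & B \subset A].
  by rewrite cards0.
rewrite inE => /andP[dB BA].
have [v vA EB] := subD _ dB BA.
have cinj := door_inj dB.
have [w wB cw] : exists2 w, w \in B & c w = c v.
  have : c v \in c @: B.
    case/andP: dB => /eqP cB _; rewrite cB !inE; apply: contra cA => /eqP cv.
    have -> : A = v |: B by rewrite EB setD1K.
    by rewrite imsetU1 cB cv; apply/eqP/setP => i; rewrite !inE orbN.
  by case/imsetP => w wB cvw; exists w.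
have [wv wA] : w != v /\ w \in A by move: wB; rewrite EB !inE => /andP[].
suff -> : [set B : {set V} | door B & B \subset A] = [set A :\ v; A :\ w].
  rewrite cards2; case: eqP => // /setP /(_ w).
  by rewrite !inE eqxx wv wA.
apply/setP => B'; rewrite !inE; apply/idP/orP => [/andP[dB' B'A]|].
  have [u uA EB'] := subD _ dB' B'A; rewrite EB'.
  have [->|uv] := eqVneq u v; first by left.
  have [->|uw] := eqVneq u w; first by right.
  have uB : u \in B by rewrite EB !inE uv.
  have : c u \in c @: B'.
    case/andP: dB' => /eqP -> _; case/andP: dB => /eqP <- _.
    exact: imset_f.
  case/imsetP => u'; rewrite EB' !inE => /andP[u'u u'A].
  have [-> |u'v] := eqVneq u' v.
    by rewrite -cw => /(cinj _ _ uB wB) /eqP; rewrite (negPf uw).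
  have u'B : u' \in B by rewrite EB !inE u'v.
  by move/(cinj _ _ uB u'B) => /eqP; rewrite eq_sym (negPf u'u).
move=> [] /eqP ->; rewrite subD1set andbT; first by rewrite -EB.
rewrite /door cardA // eqxx andbT; case/andP: dB => /eqP <- _.
rewrite EB; apply/eqP/setP => i; apply/imsetP/imsetP.
  move=> [u]; rewrite !inE => /andP[uw uA] ->.
  have [->|uv] := eqVneq u v; first by exists w; rewrite ?inE ?wv.
  by exists u => //; rewrite !inE uv.
move=> [u]; rewrite !inE => /andP[uv uA] ->.
have [->|uw] := eqVneq u w; first by exists v; rewrite // !inE eq_sym wv.
by exists u => //; rewrite !inE uw.
Qed.


Section RoomsOfDoor.
Variables (B : {set V}) (mn : I -> V).
Hypotheses (dB : dominant B) (nB : #|B|.+1 = #|I|)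
  (mnB : forall i, mn i \in B)
  (mn_min : forall i a, a \in B -> r i (mn i) <= r i a).

(** Adding such an [x] to [B] can change the minimum in the [j]-th order only. *)
Let above j x := [forall (k | k != j), r k (mn k) < r k x].

Let aboveP j x :
  reflect (forall k, k != j -> r k (mn k) < r k x) (above j x).
Proof. exact: forall_inP. Qed.

(* By [argmin_onto] and [nB], exactly two indices have the same minimum in [B];
by [room_above] and [room_aboveE], each of them gives at most one room. *)
Lemma argmin_onto v : v \in B -> exists i, mn i = v.
Proof.
move=> vB; have /dominantP/(_ v)[i hi] := dB; exists i.
by apply: (@r_inj i); apply/eqP; rewrite eqn_leq mn_min // hi.
Qed.

Lemma argmin_inj k : {in B, forall v, exists2 i, i != k & mn i = v} ->
  {in [set~ k] &, injective mn}.
Proof.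
move=> onto; apply/imset_injP; rewrite eqn_leq leq_imset_card cardsC1.
have -> : #|I|.-1 = #|B| by rewrite -nB.
apply: subset_leq_card; apply/subsetP => v /onto[i ik <-].
by rewrite imset_f // !inE.
Qed.

(** Let [P] be the set of orders in which [x] falls below the minimum of [B]. Dominance makes every
    element of [B] the minimum in some order outside [P], so [P] has at most one element by [nB]; if
    this is [k], then [mn] is injective away from [k], which forces [k] to be [i1] or [i2]. *)
Lemma room_above i1 i2 x : i1 != i2 -> mn i1 = mn i2 ->
  x \notin B -> dominant (x |: B) -> above i1 x || above i2 x.
Proof.
move=> i12 m12 xB /dominantP dx.
have lt_min k : ~~ (r k (mn k) < r k x) -> r k x < r k (mn k).
  rewrite -leqNgt leq_eqVlt => /orP[/eqP/r_inj xm|//].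
  by rewrite xm mnB in xB.
pose P := [set k | r k x < r k (mn k)].
have onto : {in B, forall v, exists2 i, i \notin P & mn i = v}.
  move=> v vB; have [i hi] := dx v; have miv : mn i = v.
    by apply: (@r_inj i); apply/eqP; rewrite eqn_leq mn_min // hi ?setU1r.
  by exists i; rewrite // inE -leqNgt miv hi ?setU11.
have P1 : #|P| <= 1.
  have : #|B| <= #|~: P|.
    apply: leq_trans (leq_imset_card mn _); apply: subset_leq_card.
    by apply/subsetP => v /onto[i iP <-]; rewrite imset_f // inE.
  by have := cardsC P; lia.
have sub_above j : P \subset [set j] -> above j x.
  move=> /subsetP Pj; apply/aboveP => k; apply: contraNT => /lt_min kP.
  by have := Pj k; rewrite !inE; apply.
have [P0|[k kP]] := set_0Vmem P; first by rewrite sub_above // P0 sub0set.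
have Pk : P = [set k].
  by apply/eqP; rewrite eq_sym eqEcard sub1set kP cards1.
have minj : {in [set~ k] &, injective mn}.
  apply: argmin_inj => v /onto[i iP iv]; exists i => //.
  by rewrite Pk inE in iP.
have : (k == i1) || (k == i2).
  apply: contraNT i12; rewrite negb_or => /andP[k1 k2].
  by apply/eqP/minj; rewrite // !inE eq_sym.
by move=> /orP[] /eqP <-; rewrite (sub_above k) ?orbT // Pk.
Qed.

(** Only elements above [j] can violate the dominance of [x |: B], and for those the witness can
    only be [j]. The twin index [j'] excludes [x \in B]. *)
Lemma room_aboveE j j' x : j != j' -> mn j = mn j' -> above j x ->
  (x \notin B) && dominant (x |: B) = [forall (y | above j y), r j y <= r j x].
Proof.
move=> jj' mjj' /aboveP xj; apply/andP/forall_inP => [[xB /dominantP dx] y|hx].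
  move=> /aboveP yj; have [i hi] := dx y.
  have [<-|ij] := eqVneq i j; first by rewrite hi ?setU11.
  by have := yj i ij; rewrite ltnNge hi // setU1r.
have xB : x \notin B.
  apply/negP => /argmin_onto[k kx].
  have [kj|kj] := eqVneq k j; last by have := xj k kj; rewrite kx ltnn.
  by have := xj j'; rewrite -mjj' -kj kx ltnn eq_sym kj jj' => /(_ isT).
split=> //; apply/dominantP => y; have [i hi] := dominantP _ dB y.
have [yj|] := boolP (above j y).
  have ij : i = j.
    apply: contraTeq (hi _ (mnB i)) => ij.
    by rewrite -ltnNge (aboveP _ _ yj).
  exists j => a; rewrite !inE => /orP[/eqP ->|aB]; first exact: hx.
  by rewrite -ij hi.
rewrite negb_forall => /existsP[k]; rewrite negb_imply -leqNgt => /andP[kj yk].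
exists k => a; rewrite !inE => /orP[/eqP ->|aB].
  by rewrite ltnW // (leq_ltn_trans yk) // xj.
by rewrite (leq_trans yk) // mn_min.
Qed.

Lemma exists_room_above j j' v : j != j' -> mn j = mn j' -> above j v ->
  exists x, forall y, (y == x) = [&& above j y, y \notin B & dominant (y |: B)].
Proof.
move=> jj' mjj' vj; case: (arg_maxnP (r j) vj) => x xj xmax.
exists x => y; apply/eqP/andP => [->|[yj]]; rewrite (room_aboveE jj' mjj') //.
  by split=> //; apply/forall_inP.
move=> /forall_inP ymax; apply: (@r_inj j); apply/eqP.
by rewrite eqn_leq [_ <= r j x]xmax // ymax.
Qed.

Lemma odd_rooms_above i1 i2 v : i1 != i2 -> mn i1 = mn i2 -> above i1 v ->
  odd #|[set x | x \notin B & dominant (x |: B)]| = ~~ [exists x, above i2 x].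
Proof.
move=> i12 m12 v1; have [x1 x1P] := exists_room_above i12 m12 v1.
set X := [set x | _ & _].
have XP x : x \in X -> above i1 x || above i2 x.
  by rewrite inE => /andP[]; exact: room_above.
have [/existsP[w w2]|/existsPn n2] := boolP [exists x, above i2 x].
  rewrite eq_sym in i12.
  have [x2 x2P] := exists_room_above i12 (esym m12) w2.
  have -> : X = [set x1; x2].
    apply/setP => y; rewrite !inE x1P x2P -andb_orl.
    have := XP y; rewrite inE.
    by case: (_ && dominant _) => [->//|]; rewrite andbF.
  (* An element above both [i1] and [i2] would exceed all the minima of [B], against its
     dominance. *)
  rewrite cards2; case: eqP => // x12.
  have := x1P x1; rewrite eqxx => /esym/and3P[/aboveP a1 _ _].
  have := x2P x1; rewrite x12 eqxx -x12 => /esym/and3P[/aboveP a2 _ _].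
  have /dominantP/(_ x1)[k hk] := dB.
  have [k1|k1] := eqVneq k i1.
    by have := a2 k; rewrite k1 eq_sym i12 ltnNge -k1 hk // => /(_ isT).
  by have := a1 k k1; rewrite ltnNge hk.
have -> : X = [set x1]; last by rewrite cards1.
apply/setP => y; rewrite inE x1P.
have := XP y; rewrite (negPf (n2 y)) orbF inE.
by case: (_ && dominant _) => [->//|]; rewrite andbF.
Qed.

End RoomsOfDoor.

Lemma card_door0 : #|door0|.+1 = #|I|.
Proof. by rewrite card_imset ?cardsC1 ?prednK //; [lia|exact: can_inj cs]. Qed.

Lemma dominant_door0 : dominant door0.
Proof.
apply/dominantP => x; have [/codomP[i ->]|xs] := boolP (x \in codom s).
  by exists i => a _; exact: r_min.
exists i0 => a /imsetP[k]; rewrite !inE => ki0 ->.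
by rewrite ltnW // r_max // eq_sym.
Qed.

(** A subset of a room is dominant, so only dominant doors matter. By [odd_rooms_above], it remains
    to see that in [door0] only one of the two twin indices has elements above it, while in any
    other dominant door both have. *)
Lemma odd_rooms_of_door B : door B ->
  odd #|[set A : {set V} | room A & B \subset A]| = (B == door0).
Proof.
move=> doorB; have /andP[/eqP cB /eqP nB] := doorB.
have -> : #|[set A : {set V} | room A & B \subset A]| =
          #|[set x | x \notin B & dominant (x |: B)]|.
  rewrite -(@card_in_imset _ _ (fun x => x |: B)) => [|x y].
    congr #|pred_of_set _|; apply/setP => A; rewrite !inE.
    apply/idP/imsetP => [/andP[/andP[dA /eqP nA] BA]|[x]].
      have : #|A :\: B| == 1 by rewrite cardsD (setIidPr BA) nA; lia.
      case/cards1P=> x Ex; have EA : A = x |: B.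
        by rewrite -Ex -[LHS](setID A B) (setIidPr BA) setUC.
      exists x => //; rewrite inE -EA dA.
      by have := set11 x; rewrite -Ex inE => /andP[->].
    rewrite inE => /andP[xB dx] ->; rewrite /room dx subsetUr cardsU1 xB.
    by rewrite add1n nB eqxx.
  rewrite !inE => /andP[xB _] /andP[yB _] /setP/(_ x).
  by rewrite !inE eqxx (negPf xB) !orbF => /esym/eqP.
have [dB|ndB] := boolP (dominant B); last first.
  have -> : [set x | x \notin B & dominant (x |: B)] = set0.
    apply/setP => x; rewrite !inE; apply/negP => /andP[_].
    by move/(dominantS (subsetUr _ _)); exact/negP.
  rewrite cards0; apply/esym/eqP => B0.
  by rewrite B0 dominant_door0 in ndB.
have [b bB] : exists b, b \in B.
  by apply/set0Pn; rewrite -card_gt0; lia.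
pose mn i := [arg min_(v < b in B) r i v].
have mnB i : mn i \in B by rewrite /mn; case: arg_minnP.
have mn_min i a : a \in B -> r i (mn i) <= r i a.
  by rewrite /mn; case: arg_minnP => // x _ h /h.
have [B0|nB0] := eqVneq B door0.
  have mns k : k != i0 -> mn k = s k.
    move=> ki0; apply: (@r_inj k); apply/eqP; rewrite eqn_leq r_min andbT.
    by rewrite mn_min // B0 imset_f // !inE.
  have /imsetP[i2] : mn i0 \in door0 by rewrite -B0.
  rewrite !inE => i20 m0; have m02 : mn i0 = mn i2 by rewrite m0 mns.
  have [v0 v0s] := proper.
  rewrite eq_sym in i20.
  rewrite (@odd_rooms_above B mn _ _ _ _ i0 i2 v0) //.
    (* Such an [x] would exceed [s i2] in the order [i0], hence be a slack element [s l] with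
       [l != i2]; but [s l] is the minimum of the order [l]. *)
    apply/existsPn => x; apply/forall_inP => h.
    have := h _ i20; rewrite m0 ltnNge => /negP; apply.
    have [/codomP[l xl]|xs] := boolP (x \in codom s); last first.
      by rewrite ltnW // r_max.
    have [l2|l2] := eqVneq l i2; first by rewrite xl l2.
    by have := h _ l2; rewrite xl ltnNge r_min.
  apply/forall_inP => k ki0; rewrite mns // ltn_neqAle r_min andbT.
  by apply: contraNneq v0s => /r_inj <-; rewrite codom_f.
have [a aB asl] : exists2 a, a \in B & a \notin codom s.
  apply/exists_inP; apply: contraNT nB0; rewrite negb_exists_in.
  move=> /forall_inP h; rewrite eqEcard; apply/andP; split; last first.
    by have := card_door0; lia.
  apply/subsetP => x xB; have := h x xB; rewrite negbK => /codomP[k xk].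
  rewrite xk imset_f // -cB.
  by apply/imsetP; exists x => //; rewrite xk cs.
(* Hence [s j] is above [j] for every [j]: in any other order, the non-slack [a] is already below
   it. *)
have sab j : forall k, k != j -> r k (mn k) < r k (s j).
  by move=> k kj; rewrite (leq_ltn_trans (mn_min _ _ aB)) // r_max.
have [i1 [i2 [i12 m12]]] : exists i1 i2, i1 != i2 /\ mn i1 = mn i2.
  have : ~~ injectiveb mn.
    apply/injectiveP => /(card_imset setT); rewrite cardsT.
    have /subset_leq_card : mn @: setT \subset B.
      by apply/subsetP => _ /imsetP[k _ ->].
    lia.
  by case/injectivePn => i1 [i2 i12 m12]; exists i1, i2.
rewrite (@odd_rooms_above B mn _ _ _ _ i1 i2 (s i1)) //.
  apply/negbTE; rewrite negbK; apply/existsP; exists (s i2).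
  by apply/forall_inP/sab.
by apply/forall_inP/sab.
Qed.

Lemma scarf : exists A, [/\ dominant A, #|A| = #|I| & c @: A = setT].
Proof.
have odd_sum (Q Q' : pred {set V}) (F : {set V} -> nat) :
    (forall A, Q A -> odd (F A) = Q' A) ->
    odd (\sum_(A | Q A) F A) = odd #|[set A | Q A & Q' A]|.
  move=> FQ; rewrite -sum1dep_card big_mkcondr /=.
  apply: (big_rec2 (fun m n => odd m = odd n)) => // A m n /FQ QA mn.
  by rewrite !oddD QA mn; case: (Q' A).
have double_count :
    \sum_(B | door B) #|[set A : {set V} | room A & B \subset A]| =
    \sum_(A | room A) #|[set B : {set V} | door B & B \subset A]|.
  under eq_bigr do rewrite -sum1dep_card.
  under [RHS]eq_bigr do rewrite -sum1dep_card.
  rewrite (exchange_big_dep room) /= => [|A B _ /andP[]//].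
  apply: eq_bigr => A rA; apply: eq_bigl => B.
  by rewrite rA.
have /set0Pn[A] : [set A | room A & c @: A == setT] != set0.
  apply: contraTneq isT => no_room; have := odd_sum _ _ _ odd_doors_of_room.
  rewrite no_room cards0 -double_count (odd_sum _ _ _ odd_rooms_of_door).
  suff -> : [set B | door B & B == door0] = [set door0] by rewrite cards1.
  apply/setP => B; rewrite !inE andb_idl // => /eqP ->.
  rewrite /door card_door0 eqxx andbT -imset_comp.
  by rewrite (eq_imset _ cs) imset_id.
by rewrite inE => /andP[/andP[dA /eqP nA] /eqP cA]; exists A.
Qed.

End Scarf.

(** * A Sperner-type lemma on the integer points of a simplex *)

Section Sperner.
Variables (I : finType) (m : nat).

(** Turns a bound on the gap between two sums into one on each coordinate; written additively
    because subtraction truncates. *)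
Lemma leq_add_sum (f g : I -> nat) k : (forall i, f i <= g i) ->
  g k + \sum_i f i <= f k + \sum_i g i.
Proof.
move=> fg; rewrite (bigD1 k) //= [\sum_i g i](bigD1 k) //= addnCA.
by rewrite !leq_add2l leq_sum.
Qed.

Lemma sum_fill (f : I -> nat) i0 : \sum_i f i <= m ->
  exists g : I -> nat, [/\ \sum_i g i = m, forall i, f i <= g i
    & forall i, i != i0 -> g i = f i].
Proof.
move=> fm; exists (fun i => if i == i0 then f i + (m - \sum_i f i) else f i).
split=> [|i|i /negPf-> //]; last by case: ifP; rewrite ?leq_addr.
rewrite (bigD1 i0) //= eqxx [X in _ + X = _](eq_bigr f) => [|i /negPf-> //].
by move: fm; rewrite [\sum_i f i](bigD1 i0) //=; lia.
Qed.

Definition grid := {x : {ffun I -> 'I_m.+1} | \sum_i x i == m}.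

Implicit Types (x y t : grid) (i j k : I).

Let coord x i : nat := val x i.

Let sum_coord x : \sum_i coord x i = m.
Proof. exact/eqP/(valP x). Qed.

Let grid_coord (g : I -> nat) : \sum_i g i = m -> exists x, coord x =1 g.
Proof.
move=> gm; have le_m i : g i <= m by rewrite -gm (bigD1 i) //= leq_addr.
have sumx : \sum_i [ffun i => inord (g i) : 'I_m.+1] i == m.
  apply/eqP; rewrite -[RHS]gm; apply: eq_bigr => i _.
  by rewrite ffunE inordK ?ltnS.
by exists (exist (fun x : {ffun I -> 'I_m.+1} => \sum_i x i == m) _ sumx) => i;
  rewrite /coord /= ffunE inordK ?ltnS.
Qed.

(* Ties between coordinates are broken by [enum_rank]. *)
Let rank i (v : grid + I) :=
  match v with
  | inl x => (coord x i * #|{: grid}| + enum_rank x).+1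
  | inr j => if j == i then 0 else (m.+1 * #|{: grid}| + enum_rank j).+1
  end.

Let rank_inl i x : rank i (inl x) <= m.+1 * #|{: grid}|.
Proof.
rewrite /= -addnS mulSn [leqRHS]addnC leq_add ?ltn_ord // leq_mul2r.
by rewrite -ltnS ltn_ord orbT.
Qed.

Let rank_inj i : injective (rank i).
Proof.
move=> [x|j] [y|k]; last 1 first.
- rewrite /=; case: (eqVneq j i) => [->|_]; case: (eqVneq k i) => [->|_] //.
  move=> [] /addnI.
  by move=> /ord_inj/enum_rank_inj->.
- move=> /= [] /(congr1 (modn^~ #|{: grid}|)).
  by rewrite !modnMDl !modn_small ?ltn_ord // => /ord_inj/enum_rank_inj->.
- by have := rank_inl i x; rewrite /=; case: eqP => //; lia.
- by have := rank_inl i y; rewrite /=; case: eqP => //; lia.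
Qed.

(** [scarf] is applied to the grid points together with one slack [inr i] of colour [i] per index.
    Let [mu] be the coordinatewise minimum of the grid points of [A], with 0 where the slack is in
    [A]. These points lie above [mu], and dominance makes the sum of [mu] exceed [m - #|I|]; so they
    are all close to [mu], and to the [g] obtained by filling [mu] up. *)
Lemma sperner (c : (I -> nat) -> I) : 1 < #|I| ->
  exists2 g : I -> nat, \sum_i g i = m
  & forall j, 0 < g j -> exists x : I -> nat,
      [/\ \sum_i x i = m, c x = j
        & forall k, x k <= g k + #|I| /\ g k <= x k + #|I|].
Proof.
move=> cardI.
pose c' v := match v with inl x => c (coord x) | inr i => i end.
have [i0 _] : exists i0 : I, i0 \in I by apply/card_gt0P/ltnW.
have [x0 _] : exists x, coord x =1 fun i => if i == i0 then m else 0.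
  by apply: grid_coord; rewrite -big_mkcond big_pred1_eq.
have proper : exists v : grid + I, v \notin codom inr.
  by exists (inl x0); apply/codomP => -[].
have rank_min i v : rank i (inr i) <= rank i v by rewrite /= eqxx.
have rank_max i j v : v \notin codom inr -> i != j -> rank i v < rank i (inr j).
  case: v => [x _ ij|k]; last by rewrite codom_f.
  rewrite [ltnRHS]/= eq_sym (negPf ij) ltnS.
  exact: leq_trans (rank_inl i x) (leq_addr _ _).
have [A [/dominantP dA _ cA]] := scarf cardI rank_inj rank_min rank_max proper
  (fun i => erefl : c' (inr i) = i) i0.
(* The witness order [i] cannot have its slack in [A], since [inr i] has rank 0 there and grid
   points have positive rank. *)
have {}dA x : exists2 i, inr i \notin A
    & forall t, inl t \in A -> coord x i <= coord t i.
  have [i hi] := dA (inl x); exists i => [|t tA].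
    by apply/negP => /hi; rewrite /= eqxx.
  have := hi _ tA; rewrite ltnS leqNgt; apply: contraNleq => lt_ti.
  apply: leq_trans (leq_addr _ _); apply: leq_trans (leq_mul lt_ti (leqnn _)).
  by rewrite mulSn addnC ltn_add2r ltn_ord.
have owner j : inr j \notin A -> exists2 t, inl t \in A & c (coord t) = j.
  have : j \in c' @: A by rewrite cA inE.
  by case/imsetP => -[t tA -> _|i iA ->]; [exists t|rewrite iA].
have [j0 j0A _] := dA x0; have [t0 t0A _] := owner _ j0A.
pose u i := [arg min_(t < t0 | inl t \in A) coord t i].
have uA i : inl (u i) \in A by rewrite /u; case: arg_minnP.
pose mu i := if inr i \in A then 0 else coord (u i) i.
have mu_le t i : inl t \in A -> mu i <= coord t i.
  by rewrite /mu /u; case: ifP => // _; case: arg_minnP => // v _ h /h.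
have sum_mu : \sum_i mu i <= m.
  by rewrite -(sum_coord t0) leq_sum // => i _; exact: mu_le.
have mu_large : m < \sum_i mu i + #|I|.
  rewrite ltnNge; apply/negP => le_m.
  (* A grid point above [mu1] would exceed the minimum of [A] in every order whose slack is absent,
     against [dA]. *)
  pose mu1 i := if inr i \in A then 0 else (mu i).+1.
  have : \sum_i mu1 i <= m.
    apply: leq_trans le_m; rewrite -sum1_card -big_split leq_sum //= => i _.
    by rewrite /mu1; case: ifP => // _; rewrite addn1.
  move=> /(sum_fill j0)[h [/grid_coord[x xh] hmu _]].
  have [i iA] := dA x; move=> /(_ _ (uA i)); apply/negP; rewrite -ltnNge xh.
  by apply: leq_trans (hmu i); rewrite /mu1 /mu (negPf iA).
(* The missing units go to [j0], whose slack is not in [A]. So [g] vanishes wherever the slack is in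
   [A], and each index of its support is the colour of a grid point of [A]. *)
have [g [sum_g mu_g g_mu]] := sum_fill j0 sum_mu.
exists g => // j gj.
have jA : inr j \notin A.
  apply: contraTN gj => jA; rewrite g_mu ?/mu ?jA //.
  by apply: contraNneq j0A => <-.
have [t tA tj] := owner j jA; exists (coord t); split=> // k.
have t_mu := leq_add_sum k (fun i => mu_le _ i tA).
have := leq_add_sum k mu_g; rewrite sum_coord in t_mu; rewrite sum_g.
have := mu_g k; have := mu_le _ k tA.
move: mu_large t_mu; lia.
Qed.

End Sperner.

From mathcomp Require Import finmap.
From HB Require Import structures.
From mathcomp Require Import all_boot all_order all_algebra.
From mathcomp Require Import all_classical all_reals all_analysis.
From mathcomp Require Import ring.
Import Order.TTheory GRing.Theory Num.Theory.
Import numFieldNormedType.Exports.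

Local Open Scope classical_set_scope.
Local Open Scope ring_scope.

(** * Convex combinations and the Fan-Browder theorem *)

Lemma convex_setP (R : numDomainType) (E : lmodType R) (A : set E) :
  convex_set A <-> forall (x y : E) (a : R),
    0 <= a -> a <= 1 -> A x -> A y -> A (a *: x + (1 - a) *: y).
Proof.
split=> [cA x y a a0 a1 Ax Ay|cA x y a /set_mem Ax /set_mem Ay].
  by have := cA x y (Itv01 a0 a1) (mem_set Ax) (mem_set Ay); rewrite inE.
exact/mem_set/cA.
Qed.

(** Membership is asked only at positive weights because [fan_browder] controls only the support of
    a grid point. *)
Lemma convex_set_sum (R : numFieldType) (E : lmodType R) (A : set E)
    (I : finType) (a : I -> R) (y : I -> E) :
  convex_set A -> (forall i, 0 <= a i) -> \sum_i a i = 1 ->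
  (forall i, 0 < a i -> A (y i)) -> A (\sum_i a i *: y i).
Proof.
move=> cA a0 a1 Ay.
(* The partial sums are normalized by their total weight. *)
suff : 0 <= \sum_i a i /\
    if \sum_i a i == 0 then \sum_i a i *: y i = 0
    else A ((\sum_i a i)^-1 *: \sum_i a i *: y i).
  by rewrite a1 oner_eq0 invr1 scale1r => -[].
apply: (big_rec2 (fun (b : R) (v : E) => 0 <= b /\
  if b == 0 then v = 0 else A (b^-1 *: v))); first by rewrite eqxx.
move=> i b v _ [b0 bv]; split; first by rewrite addr_ge0.
have := a0 i; rewrite le_eqVlt => /predU1P[<-|ai0].
  by rewrite scale0r !add0r.
rewrite gt_eqF ?ltr_wpDr //; case: eqP bv => [-> ->|/eqP b_neq0 Av].
  by rewrite !addr0 scalerA mulVf ?scale1r ?gt_eqF //; exact: Ay.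
have s0 : 0 < a i + b by rewrite ltr_wpDr.
have := (convex_setP A).1 cA (y i) (b^-1 *: v) (a i / (a i + b)).
have -> : 1 - a i / (a i + b) = b / (a i + b).
  by rewrite -{1}(@divff _ (a i + b)) ?gt_eqF // -mulrBl addrAC subrr add0r.
rewrite scalerA mulrAC divff // mul1r scalerDr scalerA mulrC; apply=> //.
- by rewrite mulr_ge0 // invr_ge0 ltW.
- by rewrite mulrC ler_pdivrMr // mul1r lerDl.
- exact: Ay.
Qed.

Lemma fan_browder (R : realType) (E : normedModType R) (C : set E)
    (H : E -> set E) :
  C !=set0 -> convex_set C -> compact C ->
  (forall x, C x -> convex_set (H x)) ->
  (forall x, C x -> exists2 y, C y & H x y) ->
  (forall x y, C x -> H x y -> \forall z \near x, C z -> H z y) ->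
  exists2 x, C x & H x x.
Proof.
move=> [x0 Cx0] cC kC cH neH openH.
have ballH x : exists ye : E * R, C x ->
    [/\ C ye.1, 0 < ye.2 & forall z, ball x (2 * ye.2) z -> C z -> H z ye.1].
  have [Cx|nCx] := pselect (C x); last by exists (0, 0).
  have [y Cy Hy] := neH x Cx.
  have /nbhs_ballP[e /= e0 He] := openH x y Cx Hy.
  (* Half of the radius serves for the covering; the other half absorbs the distance between the
     images of two close grid points. *)
  exists (y, e / 2) => _; split=> //=; first by rewrite divr_gt0.
  by rewrite mulrC divfK ?gt_eqF // => z /He.
have [ye yeP] := choice ballH.
pose y x := (ye x).1; pose e x := (ye x).2.
have : cover_compact C by rewrite -compact_cover.
move=> /(_ E C (fun x => ball x (e x))) [].
- by move=> x _; exact: ball_open.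
- by move=> x Cx; exists x => //; apply: ballxx; case: (yeP x Cx).
move=> D DC covD.
have CD (i : D) : C (val i) by apply/set_mem/DC/valP.
(* [bool] ensures that there are at least two colours. *)
pose I : finType := (D * bool)%type.
have cardI : (1 < #|I|)%N.
  have [d dD _] := covD x0 Cx0.
  rewrite card_prod card_bool (@leq_pmul2r 2 1) //.
  by apply/card_gt0P; exists [` dD]%fset.
pose z (i : I) := y (val i.1).
pose n := #|I|.
have [d [d0 dle]] : exists d, 0 < d /\ forall i : I, d <= e (val i.1).
  exists (\big[Order.min/1]_(i : I) e (val i.1)); split.
    by apply: lt_bigmin => // i _; case: (yeP _ (CD i.1)).
  by move=> i; exact: bigmin_le_cond.
have [M [M0 Mge]] : exists M, 0 < M /\ forall i, `|z i| <= M.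
  exists (1 + \sum_i `|z i|); split; first by rewrite ltr_pwDl ?sumr_ge0.
  by move=> i; rewrite (bigD1 i) //= addrCA lerDl addr_ge0 ?sumr_ge0.
(* If two grid points differ by at most [n] in each coordinate, their images differ by a sum of [n]
   terms of norm at most [n / m * M]; this [m] makes the total less than [d]. *)
pose m := (Num.truncn (n%:R * n%:R * M / d)).+1.
have mn : n%:R * n%:R * M / m%:R < d.
  by rewrite ltr_pdivrMr // [d * _]mulrC -ltr_pdivrMr // truncnS_gt.
pose phi (g : I -> nat) := \sum_i (g i)%:R / m%:R *: z i.
have phi_in (A : set E) g : (\sum_i g i)%N = m -> convex_set A ->
    (forall i, (0 < g i)%N -> A (z i)) -> A (phi g).
  move=> gm cA Az; apply: convex_set_sum => // [|i].
    by rewrite -mulr_suml -natr_sum gm divff ?pnatr_eq0.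
  by rewrite ltr_pdivlMr // mul0r ltr0n; exact: Az.
have Cphi g : (\sum_i g i)%N = m -> C (phi g).
  by move=> gm; apply: phi_in => // i _; case: (yeP _ (CD i.1)).
(* [sperner] colours all functions, so an arbitrary colour is given when [phi g] is outside [C]. *)
have colour g : exists i : I, C (phi g) -> ball (val i.1) (e (val i.1)) (phi g).
  have [Cg|nCg] := pselect (C (phi g)).
    by have [t tD tg] := covD _ Cg; exists ([` tD]%fset, true).
  by have /card_gt0P[i _] := ltnW cardI; exists i.
have [c cP] := choice colour.
have [g gm gP] := sperner m c cardI.
have Cg := Cphi g gm.
exists (phi g) => //.
(* Each [j] in the support of [g] colours some [h] close to [g]: [phi h] is within [e (val j.1)] of
   the centre [val j.1], and [phi g] within [e (val j.1)] of [phi h], so [z j] is in [H (phi g)]. *)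
apply: phi_in => // [|j /gP[h [hm hj hg]]]; first exact: cH.
have /= [_ _] := yeP _ (CD j.1); apply=> //.
have := cP _ (Cphi h hm); rewrite hj -!ball_normE /= => hjd.
apply: le_lt_trans (ler_distD (phi h) _ _) _.
rewrite mulr_natl mulr2n ltr_leD //; apply: le_trans (dle j).
apply: le_trans (ltW mn).
have -> : phi h - phi g = \sum_i ((h i)%:R - (g i)%:R) / m%:R *: z i.
  by rewrite /phi -sumrB; apply: eq_bigr => i _; rewrite mulrBl scalerBl.
have -> : n%:R * n%:R * M / m%:R = \sum_(i : I) (n%:R / m%:R * M).
  rewrite sumr_const -/n -mulr_natl; ring.
apply: le_trans (ler_norm_sum _ _ _) _; apply: ler_sum => i _.
rewrite normrZ ler_pM // normrM normfV (ger0_norm (ler0n R m)).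
rewrite ler_pM2r ?invr_gt0 ?ltr0n //.
have [hgi ghi] := hg i.
rewrite ler_norml lerBrDr [- _ + _]addrC !lerBlDr -!natrD !ler_nat.
by rewrite ghi addnC hgi.
Qed.

(** * Enlarged maps, strict upper level sets and semicontinuity *)

Lemma enlargeP (R : realType) (E : normedModType R) (C : set E)
    (K : E -> set E) (e : R) (x y : E) : 0 < e ->
  enlarge C K e x y <-> C y /\ exists2 u, K x u & `|y - u| < e.
Proof.
move=> e0; split=> [[[u Ku [b]]]|[Cy [u Ku yu]]].
  rewrite -ball_normE /= sub0r normrN => b1 <- Cy; split=> //; exists u => //.
  by rewrite addrC addKr normrZ gtr0_norm // gtr_pMr.
split=> //; exists u => //; exists (e^-1 *: (y - u)).
  rewrite -ball_normE /= sub0r normrN normrZ gtr0_norm ?invr_gt0 //.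
  by rewrite mulrC ltr_pdivrMr // mul1r.
by rewrite scalerA divff ?gt_eqF // scale1r addrC subrK.
Qed.

Lemma enlarge_convex (R : realType) (E : normedModType R) (C : set E)
    (K : E -> set E) (e : R) (x : E) : 0 < e ->
  convex_set C -> convex_set (K x) -> convex_set (enlarge C K e x).
Proof.
move=> e0 /convex_setP cC /convex_setP cK; apply/convex_setP => y z a a0 a1.
move=> /enlargeP[]// Cy [u Ku yu] /enlargeP[]// Cz [v Kv zv].
apply/enlargeP => //; split; first exact: cC.
exists (a *: u + (1 - a) *: v); first exact: cK.
rewrite opprD addrACA -!scalerBr (le_lt_trans (ler_normD _ _)) // !normrZ.
have b0 : 0 <= 1 - a by rewrite subr_ge0.
rewrite (ger0_norm a0) (ger0_norm b0).
(* The strict inequality comes from the first term when [a] is positive and from the second when [a]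
   is 0. *)
have [->|a_neq0] := eqVneq a 0; first by rewrite mul0r add0r subr0 mul1r.
have -> : e = a * e + (1 - a) * e by ring.
by rewrite ltr_leD ?ler_wpM2l ?(ltW zv) // ltr_pM2l // lt_neqAle eq_sym a_neq0.
Qed.

(** Two points of the strict level set lie in the weak one at level [Num.min (g y) (g z)], which is
    still greater than [a]. *)
Lemma quasiconcave_gt_convex (R : realType) (E : lmodType R) (C : set E)
    (g : E -> R) (a : R) :
  quasiconcave_on C g -> convex_set [set y | C y /\ a < g y].
Proof.
move=> qg; apply/convex_setP => y z b b0 b1 [Cy ay] [Cz az].
have /convex_setP/(_ y z b b0 b1) := qg (Num.min (g y) (g z)).
case=> /= [||Cw le_w]; rewrite ?ge_min ?lexx ?orbT //.
by split=> //; apply: lt_le_trans le_w; rewrite lt_min ay.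
Qed.

Lemma nbhs_within_subspace (T : topologicalType) (C P : set T) (x : T) :
  C x -> nbhs (x : subspace C) P -> \forall z \near x, C z -> P z.
Proof. by move=> Cx; case: (nbhs_subspaceP C x). Qed.

(** For [z] in [C], the point [y] is in the enlarged image of [z] exactly when [K z] meets the
    relatively open set of the points of [C] in [ball y e]; lower semicontinuity applies to this
    set. *)
Lemma enlarge_lower_section (R : realType) (E : normedModType R) (C : set E)
    (K : E -> set E) (e : R) (x y : E) :
  0 < e -> setvalued_map C K -> setvalued_lsc C K -> C x ->
  enlarge C K e x y -> \forall z \near x, C z -> enlarge C K e z y.
Proof.
move=> e0 K_map K_lsc Cx /enlargeP[]// Cy [u Ku yu].
have oU : open (C `&` ball y e : set (subspace C)).
  apply/open_subspaceP; exists (ball y e); first exact: ball_open.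
  by rewrite setIAC setIid setIC.
have /(nbhs_within_subspace Cx) : nbhs (x : subspace C)
    [set z | C z /\ (K z `&` (C `&` ball y e)) !=set0].
  apply: open_nbhs_nbhs; split; first by apply: K_lsc oU; exact: subIsetl.
  split=> //; exists u; split=> //.
  by split; [exact: K_map Ku|rewrite -ball_normE].
apply: filterS => z /[apply].
case=> _ [v [Kv [_ yv]]]; apply/enlargeP => //; split=> //; exists v => //.
by rewrite -ball_normE in yv.
Qed.

Lemma lsc_on_gt (R : realType) (T : topologicalType) (C : set T) (g : T -> R)
    (a : R) (x : T) :
  lsc_on C g -> C x -> a < g x -> \forall z \near x, C z -> a < g z.
Proof.
move=> lg Cx ax; have [|V xV Vg] := lg x a; first by rewrite lte_fin.
apply: filterS (nbhs_within_subspace Cx xV) => z /[apply]/Vg.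
by rewrite lte_fin.
Qed.

Theorem theorem2p4 (R : realType) (E : completeNormedModType R)
    (C : set E) (C_nonempty : C !=set0) (C_convex : convex_set C)
    (C_compact : compact C)
    (K : E -> set E) (K_map : setvalued_map C K) (K_lsc : setvalued_lsc C K)
    (K_convex : forall x, C x -> convex_set (K x))
    (K_nonempty : forall x, C x -> K x !=set0)
    (f : E -> E -> R)
    (f_lsc : forall y, C y -> lsc_on C (fun x => f x y))
    (f_quasiconcave : forall x, C x -> quasiconcave_on C (fun y => f x y))
    (eps0 : R) (eps0_gt0 : 0 < eps0)
    (f_diag : forall x, C x -> enlarge C K eps0 x x -> f x x <= 0) :
  forall eps : R, 0 < eps -> eps < eps0 ->
    exists x_eps : E, closure (setvalued_fix C (enlarge C K eps)) x_eps /\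
      (forall y, enlarge C K eps x_eps y -> f x_eps y <= 0).
Proof.
move=> eps eps_gt0 eps_lt; apply: contrapT => no_x.
set F := closure _ in no_x.
have bad x : F x -> exists2 y, enlarge C K eps x y & 0 < f x y.
  move=> Fx; apply: contrapT => h; apply: no_x; exists x; split=> // y Ky.
  by rewrite leNgt; apply/negP => fy; apply: h; exists y.
pose H x := [set y | enlarge C K eps x y /\ (F x -> 0 < f x y)].
have [x Cx|x Cx|x y Cx [Kxy fxy]|x Cx [Kxx fxx]] :=
  fan_browder (H := H) C_nonempty C_convex C_compact.
- apply/convex_setP => y z a a0 a1 [Ky fy] [Kz fz]; split.
    have := enlarge_convex eps_gt0 C_convex (K_convex x Cx).
    by move=> /convex_setP; apply.
  move=> Fx.
  have := quasiconcave_gt_convex (a := 0) (f_quasiconcave x Cx).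
  move=> /convex_setP/(_ y z a a0 a1)[]//.
    by split; [exact: Ky.2|exact: fy].
  by split; [exact: Kz.2|exact: fz].
- have [Fx|nFx] := pselect (F x).
    by have [y Ky fy] := bad x Fx; exists y; [exact: Ky.2|split].
  have [u Ku] := K_nonempty x Cx; have Cu := K_map x Cx u Ku.
  exists u => //; split=> //; apply/enlargeP => //; split=> //.
  by exists u => //; rewrite subrr normr0.
- have Cy := Kxy.2.
  have near_K := enlarge_lower_section eps_gt0 K_map K_lsc Cx Kxy.
  (* At a point of [F], positivity of [f] persists nearby, in or out of [F]. Off [F], which is
     closed, the condition on [f] is vacuous nearby. *)
  have [Fx|nFx] := pselect (F x).
    apply: filterS2 near_K (lsc_on_gt (f_lsc y Cy) Cx (fxy Fx)) => z Kz fz Cz.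
    by split=> [|_]; [exact: Kz|exact: fz].
  have near_F : \forall z \near x, ~ F z.
    apply: (open_nbhs_nbhs (A := ~` F)); split=> //.
    exact/closed_openC/closed_closure.
  by apply: filterS2 near_K near_F => z Kz nFz Cz; split=> [|/nFz//]; exact: Kz.
have Fx : F x by apply: subset_closure.
have := fxx Fx; rewrite ltNge f_diag //; apply/enlargeP => //.
have /enlargeP[//|_ [u Ku xu]] := Kxx.
by split=> //; exists u => //; exact: lt_trans eps_lt.
Qed.
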